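(* $\mathrm{sc}(\mathbb{R}^{\mathbb{R}})=\omega$.
   Context: $\mathbb{R}^{\mathbb{R}}$ is the set of all functions $f:\mathbb{R}\to\mathbb{R}$. A difference operator is a map $D:\mathbb{R}^{\mathbb{R}}\to\mathbb{R}^{\mathbb{R}}$ of the form $(Df)(x)=\sum_{i=1}^n a_i f(x+b_i)$ with $a_i,b_i\in\mathbb{R}$; $\mathcal{D}$ is the set of difference operators. A system of difference equations is a set $S\subset\mathcal{D}\times\mathbb{R}^{\mathbb{R}}$; a function $f:\mathbb{R}\to\mathbb{R}$ is a solution to $S$ if $Df=g$ for every $(D,g)\in S$. A subsystem of $S$ is a subset of $S$. For $\mathcal{F}\subset\mathbb{R}^{\mathbb{R}}$ the solvability cardinal $\mathrm{sc}(\mathcal{F})$ is the minimal cardinal $\kappa$ with the following property: for every system $S$ of difference equations, if every subsystem of $S$ of cardinality less than $\kappa$ has a solution in $\mathcal{F}$, then $S$ has a solution in $\mathcal{F}$. *)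

(* Defs.v *)
From mathcomp Require Import all_boot all_order all_algebra.
From mathcomp Require Import boolp classical_sets functions cardinality reals.

Set Implicit Arguments.
Unset Strict Implicit.
Unset Printing Implicit Defensive.

Import Order.TTheory GRing.Theory Num.Theory.
Local Open Scope classical_set_scope.
Local Open Scope ring_scope.
Local Open Scope card_scope.

Definition difference_operator (R : realType) (D : (R -> R) -> (R -> R)) : Prop :=
  exists (n : nat) (a b : 'I_n -> R),
    forall (f : R -> R) (x : R), D f x = \sum_(i < n) a i * f (x + b i).

Definition difference_system (R : realType)
    (S : set (((R -> R) -> (R -> R)) * (R -> R))) : Prop :=
  forall D g, S (D, g) -> difference_operator D.

Definition solution (R : realType)
    (S : set (((R -> R) -> (R -> R)) * (R -> R))) (f : R -> R) : Prop :=
  forall D g, S (D, g) -> D f = g.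

Definition solvable_in (R : realType) (F : set (R -> R))
    (S : set (((R -> R) -> (R -> R)) * (R -> R))) : Prop :=
  exists2 f, F f & solution S f.

Definition card_lt (T U : Type) (A : set T) (B : set U) : Prop :=
  A #<= B /\ ~ (B #<= A).

(* Cardinals are represented by arbitrary sets, up to equipotence: K stands for
   the cardinal kappa. *)
Definition solvability_property (R : realType) (F : set (R -> R))
    (T : Type) (K : set T) : Prop :=
  forall S : set (((R -> R) -> (R -> R)) * (R -> R)),
    difference_system S ->
    (forall S', S' `<=` S -> card_lt S' K -> solvable_in F S') ->
    solvable_in F S.

(* "sc(F) is the cardinality of K": K has the property, and it is least among
   all cardinals that do. *)
Definition is_solvability_cardinal (R : realType) (F : set (R -> R))
    (T : Type) (K : set T) : Prop :=
  solvability_property F K /\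
  forall (U : Type) (L : set U), solvability_property F L -> K #<= L.

(* Main.v *)
Require Import Defs.
From mathcomp Require Import all_boot all_order all_algebra.
From mathcomp Require Import boolp classical_sets functions cardinality reals.
From mathcomp Require Import finmap ereal numfun lebesgue_measure.

(** Two facts make the solvability cardinal equal to omega.

    Finite subsystems decide solvability.  An equation D f = g splits into one
    scalar condition D f x = g x for each x, and the functions satisfying it
    form a set of functions that is stable under affine combinations and
    depends on finitely many values of f.  Such sets are as good as compact: if
    any finitely many of them meet, they all meet ([affine_compactness]).  By
    Zorn's lemma the family can be enlarged to a maximal family of affine sets
    with the finite intersection property.  The values at x of the functions in
    a finite intersection form a nonempty affine subset of the field, that is,
    a point or the whole line; hence some v can be prescribed at x without
    losing the property ([finite_intersection_evaluates_to]), and a maximal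
    family prescribes a value at every x.  The function so obtained lies in
    each set, because membership is decided by finitely many values.

    No finite bound suffices.  Let b_1, ..., b_n be reals that are linearly
    independent over the integers (powers of a transcendental number) and G the
    group they generate, and consider
      f(x + b_i) - f(x) = 0  for i = 1, ..., n,
      sum_i (f(x + b_i) - f(x)) = 1_G(x).
    The first n equations make the left-hand side of the last one vanish, so
    there is no solution.  Without the i-th equation there is one: the i-th
    coordinate on G, extended by 0.  A subsystem with fewer than n equations
    always omits one of the first n. *)

Set Implicit Arguments.
Unset Strict Implicit.
Unset Printing Implicit Defensive.

Import Order.TTheory GRing.Theory Num.Theory.
Local Open Scope classical_set_scope.
Local Open Scope ring_scope.

(** * Compactness of families of affine sets of functions *)

Definition finite_intersection_property (T : Type) (A : set (set T)) : Prop :=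
  forall B, finite_set B -> B `<=` A -> \bigcap_(c in B) c !=set0.

(** This makes the finite intersection property of [C `|` A] pass to unions of
    chains in A; the first alternative also covers the empty chain. *)
Lemma finite_sub_bigcup_chain (T : Type) (C B : set T) (F : set (set T)) :
  finite_set B -> total_on F subset -> B `<=` C `|` \bigcup_(A in F) A ->
  B `<=` C \/ exists2 A, F A & B `<=` C `|` A.
Proof.
elim/Pchoice: T => T in C B F *.
move=> /finite_seqP[s ->] totF; elim: s => [|x s IHs] sub; first by left.
have /IHs{}IHs : [set` s] `<=` C `|` \bigcup_(A in F) A.
  by move=> y ys; apply: sub; rewrite /= inE ys orbT.
have consE (D : set T) : D x -> [set` s] `<=` D -> [set` x :: s] `<=` D.
  by move=> Dx sD y; rewrite /= inE => /predU1P[->//|]; exact: sD.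
have [Cx|[A FA Ax]] : (C `|` \bigcup_(A in F) A) x.
  by apply: sub; rewrite /= mem_head.
- case: IHs => [sC|[A FA sA]]; first by left; exact: consE.
  by right; exists A => //; apply: consE => //; left.
- right; case: IHs => [sC|[A' FA' sA']].
    by exists A => //; apply: consE => [|y /sC]; [right|left].
  have [AA'|A'A] := totF _ _ FA FA'.
    by exists A' => //; apply: consE => //; right; exact: AA'.
  exists A => //; apply: consE; first by right.
  by apply: subset_trans sA' _; apply: setUS.
Qed.

Section Compactness.
Context {X : eqType} {K : fieldType}.
Implicit Types (f g : X -> K) (c : set (X -> K)).

Definition affine_set c : Prop :=
  forall f g t, c f -> c g -> c (fun x => f x + t * (g x - f x)).

Definition finitely_determined c : Prop :=
  exists s : seq X, forall f g, {in s, f =1 g} -> c f -> c g.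

(** These sets are themselves affine, so that prescribing a value of f is one
    more condition of the kind that the families below consist of. *)
Definition evaluates_to (x : X) (v : K) : set (X -> K) := [set f | f x = v].

Lemma affine_evaluates_to x v : affine_set (evaluates_to x v).
Proof. by move=> f g t; rewrite /evaluates_to /= => -> ->; rewrite subrr mulr0 addr0. Qed.

(** A nonempty affine subset of a field is a point or everything.  If the
    functions in some finite intersection all take one and the same value at x,
    that value is consistent with any other finite intersection, since the two
    meet; if no finite intersection fixes the value at x, each attains all
    values there, and any v will do. *)
Lemma finite_intersection_evaluates_to (A : set (set (X -> K))) (x : X) :
  A `<=` affine_set -> finite_intersection_property A ->
  exists v, finite_intersection_property (A `|` [set evaluates_to x v]).
Proof.
move=> affA fipA.
suff [v vP] : exists v, forall B, finite_set B -> B `<=` A ->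
    exists2 f, (\bigcap_(c in B) c) f & f x = v.
  exists v => B finB BA.
  have [f Bf fx] : exists2 f,
      (\bigcap_(c in B `\ evaluates_to x v) c) f & f x = v.
    by apply: vP => [|c [/BA[//|->]]]; [exact: finite_setD | case].
  exists f => c Bc; have [->//|cN] := EM (c = evaluates_to x v).
  exact: Bf.
have [[B0 [v0 [finB0 B0A B0v]]]|nopin] := EM (exists B v, [/\ finite_set B,
    B `<=` A & forall f, (\bigcap_(c in B) c) f -> f x = v]).
  exists v0 => B finB BA.
  have [f Bf] : \bigcap_(c in B `|` B0) c !=set0.
    by apply: fipA; rewrite ?finite_setU // => c [/BA|/B0A].
  exists f; first by move=> c Bc; apply: Bf; left.
  by apply: B0v => c B0c; apply: Bf; right.
(* Here v = 0: the line through f and g, which differ at x, takes it. *)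
exists 0 => B finB BA; have [f Bf] := fipA B finB BA.
have [g Bg gx] : exists2 g, (\bigcap_(c in B) c) g & g x <> f x.
  apply: contrapT => nog; apply: nopin; exists B, (f x); split => // g Bg.
  by apply: contrapT => gx; apply: nog; exists g.
have gfx : g x - f x != 0 by rewrite subr_eq0; exact/eqP.
exists (fun y => f y + (- f x / (g x - f x)) * (g y - f y)).
  by move=> c Bc; apply: (affA _ (BA _ Bc)); [exact: Bf | exact: Bg].
by rewrite divfK // subrr.
Qed.

(** In a maximal enlargement A of C, every x has a value v with
    [evaluates_to x v] in A.  These values define a function, which lies in c
    because c meets the prescriptions at the finitely many points that decide
    membership in c. *)
Theorem affine_compactness (C : set (set (X -> K))) :
  C `<=` affine_set -> C `<=` finitely_determined ->
  finite_intersection_property C -> \bigcap_(c in C) c !=set0.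
Proof.
move=> affC detC fipC.
(* C is kept outside A so that the empty chain has an upper bound. *)
pose P (A : set (set (X -> K))) :=
  A `<=` affine_set /\ finite_intersection_property (C `|` A).
have [F FP totF|A [[affA fipA] maxA]] := @Zorn_bigcup _ P.
  split=> [c [A /FP[affA _] /affA//]|B finB].
  move=> /(finite_sub_bigcup_chain finB totF)[BC|[A /FP[_ fipA] BA]].
    exact: fipC.
  exact: fipA.
have {maxA} evalA x : exists v, A (evaluates_to x v).
  have affCA : C `|` A `<=` affine_set by move=> c [/affC|/affA].
  have [v fipv] := finite_intersection_evaluates_to x affCA fipA.
  exists v; apply: contrapT => nAv.
  apply: (maxA (A `|` [set evaluates_to x v])).
    by split=> [c|sub]; [left | apply: nAv; apply: sub; right].
  split=> [c [/affA//|->]|]; first exact: affine_evaluates_to.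
  by rewrite setUA.
have [f fA] := choice evalA.
exists f => c Cc; have [s cs] := detC c Cc.
pose B := c |` [set evaluates_to x (f x) | x in [set` s]].
have [g Bg] : \bigcap_(c in B) c !=set0.
  apply: fipA => [|_ [->|[x _ <-]]]; [|by left|by right].
  by rewrite finite_setU; split; [exact: finite_set1 | exact: finite_image].
apply: (cs g) => [x xs|]; last by apply: Bg; left.
by apply: (Bg (evaluates_to x (f x))); right; exists x.
Qed.

End Compactness.

(** * Solvability is decided by finite subsystems *)

Section DifferenceOperators.
Context {R : realType}.
Implicit Types (D : (R -> R) -> (R -> R)) (f g : R -> R).

(** Allows a difference operator to be presented with its coefficients indexed
    by any finite type. *)
Lemma difference_operatorP (I : finType) (a b : I -> R) D :
  (forall f x, D f x = \sum_i a i * f (x + b i)) -> difference_operator D.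
Proof.
move=> DE; exists #|I|, (a \o enum_val), (b \o enum_val) => f x.
by rewrite DE (reindex _ (onW_bij _ (enum_val_bij I))).
Qed.

Definition equation_solutions D g (x : R) : set (R -> R) :=
  [set f | D f x = g x].

Lemma affine_equation_solutions D g x :
  difference_operator D -> affine_set (equation_solutions D g x).
Proof.
move=> [n [a [b DE]]] f h t; rewrite /equation_solutions /= !DE => fg hg.
under eq_bigr do rewrite mulrDr mulrCA mulrBr.
by rewrite big_split /= -mulr_sumr sumrB fg hg subrr mulr0 addr0.
Qed.

Lemma finitely_determined_equation_solutions D g x :
  difference_operator D -> finitely_determined (equation_solutions D g x).
Proof.
move=> [n [a [b DE]]]; exists [seq x + b i | i : 'I_n] => f h fh.
rewrite /equation_solutions /= !DE => <-; apply: eq_bigr => i _.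
by rewrite fh //; apply/codomP; exists i.
Qed.

End DifferenceOperators.

Lemma card_lt_natP (T : Type) (A : set T) :
  card_lt A [set: nat] <-> finite_set A.
Proof.
split=> [[_ /finite_setPn//]|finA]; split; last exact/finite_setPn.
exact: finite_set_countable.
Qed.

(** Finitely many scalar conditions come from finitely many equations of S,
    which have a common solution; compactness does the rest. *)
Lemma solvability_property_nat (R : realType) :
  solvability_property [set: R -> R] [set: nat].
Proof.
move=> S diffS finS.
pose C := [set c | exists2 p : ((R -> R) -> (R -> R)) * (R -> R), S p &
                     exists x, c = equation_solutions p.1 p.2 x].
have [] := @affine_compactness _ _ C.
- by move=> _ [[D g] /diffS Dd [x ->]]; exact: affine_equation_solutions.
- move=> _ [[D g] /diffS Dd [x ->]].
  exact: finitely_determined_equation_solutions.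
- move=> B finB BC.
  (* h selects, for each scalar condition, an equation that it comes from. *)
  have /choice[h hP] c : exists p, B c ->
      S p /\ exists x, c = equation_solutions p.1 p.2 x.
    have [/BC[p Sp pc]|nBc] := EM (B c); first by exists p.
    by exists (id, fun=> 0).
  have [||f _ solf] := finS (h @` B).
  + by move=> _ [c /hP[Sc _] <-].
  + by apply/card_lt_natP; exact: finite_image.
  exists f => c Bc; have [_ [x ->]] := hP c Bc.
  rewrite /equation_solutions /=; congr (_ x).
  by apply: solf; exists c => //; case: (h c).
- move=> f Cf; exists f => // D g SDg; apply/funext => x.
  by apply: (Cf (equation_solutions D g x)); exists (D, g) => //; exists x.
Qed.

(** * Reals that are linearly independent over the integers *)

(** There are countably many integer polynomials, each with finitely many roots,
    while the unit interval is uncountable, having positive measure. *)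
Lemma exists_transcendental (R : realType) :
  exists t : R, forall p : {poly int}, p != 0 -> ~~ root (map_poly intr p) t.
Proof.
pose roots (p : {poly int}) := [set t : R | root (map_poly intr p) t].
pose alg := \bigcup_(p in [set p | p != 0]) roots p.
have calg : countable alg.
  apply: bigcup_countable => [|p /= p0]; first exact: countableP.
  apply: finite_set_countable; apply: contrapT => inf.
  have [B Broots] := infinite_set_fset (size (map_poly intr p : {poly R})) inf.
  rewrite leqNgt => /negP; apply; apply: max_poly_roots.
  - by rewrite map_poly_eq0_id0 // intr_eq0 lead_coef_eq0.
  - by apply/allP => t tB; exact: Broots.
  - exact: fset_uniq.
have : ~ (`[0, 1] `<=` alg).
  move=> sub.
  have := countable_lebesgue_measure0 (sub_countable (subset_card_le sub) calg).
  rewrite lebesgue_measure_itv /= lte01 oppr0 adde0 => -[/eqP].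
  by rewrite oner_eq0.
move=> /existsNP[t /not_implyP[_ nalg]]; exists t => p p0.
by apply/negP => rpt; apply: nalg; exists p.
Qed.

Section Lattice.
Context {R : realType} {n : nat} (b : 'I_n -> R).
Implicit Types (m : {ffun 'I_n -> int}) (x : R) (i k : 'I_n).

Definition comb m : R := \sum_i (m i)%:~R * b i.

Definition Z_independent : Prop := forall m, comb m = 0 -> m = 0.

(** The i-th coordinate of x in the lattice generated by b; the default 0 of
    [xget] extends it by zero outside the lattice. *)
Definition coord i x : R := (xget 0 [set m | comb m = x] i)%:~R.

Definition unit_vector k : {ffun 'I_n -> int} := [ffun i => (i == k)%:R].

Lemma combD m m' : comb (m + m') = comb m + comb m'.
Proof.
by rewrite /comb -big_split; apply: eq_bigr => i _; rewrite ffunE intrD mulrDl.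
Qed.

Lemma combB m m' : comb (m - m') = comb m - comb m'.
Proof. by apply/(addIr (comb m')); rewrite -combD !subrK. Qed.

Lemma comb_unit_vector k : comb (unit_vector k) = b k.
Proof.
rewrite /comb (bigD1 k) //= ffunE eqxx mul1r big1 ?addr0 // => i ik.
by rewrite ffunE (negbTE ik) mul0r.
Qed.

Hypothesis b_indep : Z_independent.

Lemma coord_comb i m : coord i (comb m) = (m i)%:~R.
Proof.
rewrite /coord; case: xgetP => [m' _ /= m'm|/(_ m)/(_ erefl)//].
by have /b_indep/subr0_eq -> : comb (m' - m) = 0 by rewrite combB m'm subrr.
Qed.

Lemma coord_notin i x : ~ range comb x -> coord i x = 0.
Proof.
move=> nx; rewrite /coord; case: xgetP => [m _ /= mx|_]; last by rewrite ffunE.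
by case: nx; exists m.
Qed.

(** The shift by b_k permutes both the lattice and its complement, on which the
    coordinates vanish. *)
Lemma coord_shift i k x :
  coord i (x + b k) - coord i x = (i == k)%:R * \1_(range comb) x.
Proof.
rewrite indicE; have [[m _ <-]|nx] := EM (range comb x).
  rewrite mem_set ?mulr1; last by exists m.
  rewrite -(comb_unit_vector k) -combD !coord_comb !ffunE intrD addrAC subrr add0r.
  by case: eqP.
rewrite memNset // mulr0 !coord_notin ?subrr // => -[m _ mx].
by apply: nx; exists (m - unit_vector k) => //; rewrite combB mx comb_unit_vector addrK.
Qed.

End Lattice.

(** An integer relation between powers of t is a polynomial with root t. *)
Lemma exists_Z_independent (R : realType) n :
  exists b : 'I_n -> R, Z_independent b.
Proof.
have [t tP] := exists_transcendental R; exists (fun i => t ^+ i) => m m0.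
have p0 : \sum_(i < n) m i *: 'X^i = 0 :> {poly int}.
  apply: contrapT => /eqP/tP/negP; apply; apply/eqP.
  rewrite rmorph_sum /= horner_sum -[RHS]m0; apply: eq_bigr => i _.
  by rewrite map_polyZ map_polyXn hornerZ hornerXn.
apply/ffunP => i; rewrite ffunE; move/(congr1 (fun p : {poly int} => p`_i)): p0.
rewrite coef0 coef_sum (bigD1 i) //= coefZ coefXn eqxx mulr1 big1 ?addr0 //.
by move=> j ji; rewrite coefZ coefXn eq_sym (inj_eq val_inj) (negbTE ji) mulr0.
Qed.

(** * Unsolvable systems whose small subsystems are solvable *)

Definition shift_diff (R : realType) (b : R) (f : R -> R) (x : R) : R :=
  f (x + b) - f x.

Lemma difference_operator_sum_shift_diff (R : realType) (I : finType) (b : I -> R) :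
  difference_operator (fun f x => \sum_i shift_diff (b i) f x).
Proof.
apply: (@difference_operatorP _ (I * bool)%type (fun p => (-1) ^+ p.2)
          (fun p => if p.2 then 0 else b p.1)) => f x.
(* The boolean [true] marks the terms - f x, and [false] the f (x + b i). *)
rewrite -(pair_bigA _ (fun i (e : bool) => (-1) ^+ e * f (x + if e then 0 else b i))).
apply: eq_bigr => i _.
by rewrite big_bool /= addr0 mul1r mulN1r addrC.
Qed.

Lemma difference_operator_shift_diff (R : realType) (b : R) :
  difference_operator (shift_diff b).
Proof.
have := difference_operator_sum_shift_diff (fun _ : 'I_1 => b).
by congr difference_operator; apply/funext => f; apply/funext => x; rewrite big_ord1.
Qed.

(** The first equation contradicts the others taken together.  Its right-hand
    side is supported on the lattice because the coordinates of
    [coord_shift], which solve the subsystems lacking a homogeneous equation,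
    vary only there. *)
Definition critical_system (R : realType) n (b : 'I_n -> R) :
    set (((R -> R) -> (R -> R)) * (R -> R)) :=
  (fun f x => \sum_i shift_diff (b i) f x, \1_(range (comb b))) |`
  range (fun i => (shift_diff (b i), fun=> 0)).

Lemma critical_system_unsolvable (R : realType) n (b : 'I_n -> R) :
  ~ solvable_in [set: R -> R] (critical_system b).
Proof.
move=> [f _ solf].
(* At 0, a lattice point, the sum of the zero differences should be 1. *)
have /(congr1 (@^~ 0)) := solf _ _ (or_introl erefl).
rewrite big1 => [|i _]; last first.
  by have -> := solf (shift_diff (b i)) (fun=> 0) (or_intror (ex_intro2 _ _ i I erefl)).
rewrite indicE mem_set => [/eqP|]; first by rewrite eq_sym oner_eq0.
by exists 0 => //; rewrite /comb big1 // => i _; rewrite ffunE mul0r.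
Qed.

(** The i-th coordinate is invariant under every shift but the i-th, and its
    i-th difference is the indicator function of the lattice. *)
Lemma critical_system_subsystem (R : realType) n (b : 'I_n -> R) i S' :
  Z_independent b -> S' `<=` critical_system b ->
  ~ S' (shift_diff (b i), fun=> 0) -> solvable_in [set: R -> R] S'.
Proof.
move=> bind S'S niS'; exists (coord b i) => // D g S'Dg; apply/funext => x.
have [[-> ->]|[k _ [Dk gk]]] := S'S _ S'Dg.
  under eq_bigr => k _ do rewrite /shift_diff coord_shift //.
  rewrite (bigD1 i) //= eqxx mul1r big1 ?addr0 // => k ki.
  by rewrite eq_sym (negbTE ki) mul0r.
rewrite -Dk -gk /shift_diff coord_shift //; case: eqP => [ik|_]; last exact: mul0r.
by case: niS'; rewrite ik Dk gk.
Qed.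

(** Guarantees that the critical system really has n homogeneous equations; the
    coordinates tell their operators apart. *)
Lemma shift_diff_family_inj (R : realType) n (b : 'I_n -> R) :
  Z_independent b -> injective (fun i => shift_diff (b i)).
Proof.
move=> bind i k /(congr1 (fun D => D (coord b i) 0)).
have b0 : range (comb b) 0.
  by exists 0 => //; rewrite /comb big1 // => j _; rewrite ffunE mul0r.
rewrite /shift_diff !coord_shift // eqxx indicE mem_set // !mulr1.
by case: eqP => // _ /eqP; rewrite oner_eq0.
Qed.

(** If L has n elements, a subsystem of the n-th critical system that is smaller
    than L cannot contain all n homogeneous equations, so it is solvable. *)
Lemma not_solvability_property_finite (R : realType) (U : Type) (L : set U) :
  finite_set L -> ~ solvability_property [set: R -> R] L.
Proof.
move=> /finite_setP[n Ln] propL; have [b bind] := exists_Z_independent R n.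
apply: (@critical_system_unsolvable R n b); apply: propL.
  move=> D g [[-> _]|[i _ [<- _]]].
    exact: difference_operator_sum_shift_diff.
  exact: difference_operator_shift_diff.
move=> S' S'S [_ nLS'].
have [i niS'] : exists i, ~ S' (shift_diff (b i), fun=> 0).
  apply: contrapT => /forallNP allS'; apply: nLS'.
  rewrite (card_le_eql Ln) (card_le_eql card_II).
  pose h i := (shift_diff (b i), (fun=> 0) : R -> R).
  have injh : {in [set: 'I_n] &, injective h}.
    by move=> i k _ _ [/(shift_diff_family_inj bind)].
  rewrite -(card_le_eql (inj_card_eq injh)); apply: subset_card_le.
  by move=> _ [i _ <-]; exact: contrapT (allS' i).
exact: critical_system_subsystem niS'.
Qed.

Theorem theorem2p1 (R : realType) :
  is_solvability_cardinal [set: R -> R]%classic [set: nat]%classic.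
Proof.
split; first exact: solvability_property_nat.
move=> U L propL; apply/infiniteP => finL.
exact: not_solvability_property_finite finL propL.
Qed.
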